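(* Let $(X,d)$ and $(\Lambda,\rho)$ be compact metric spaces, let $\omega:\Lambda\times X\to X$ be continuous, and fix a Borel probability measure $p$ on $\Lambda$. Suppose $\omega$ is $\mathbb{P}$-weakly hyperbolic, i.e. $\mathbb{P}(S)=1$ where $S=\{\sigma\in\Omega:\lim_{n\to\infty}\operatorname{Diam}(\omega_{\sigma_1}\circ\cdots\circ\omega_{\sigma_n}(X))=0\}$. Then for any continuous function $f:X\to\mathbb{R}$, any $x\in X$ and $\mathbb{P}$-almost every $\sigma\in\Omega$, $$\lim_{n\to\infty}\frac1n\sum_{j=1}^n f(\omega_{\sigma_j}\circ\cdots\circ\omega_{\sigma_1}(x))=\int_X f\,d\mu_p,$$ where $\mu_p$ is the unique fixed point of the operator $T_p$.
   Context: $\omega_\lambda(x)=\omega(\lambda,x)$. $\Omega=\Lambda^{\mathbb{N}}$ with the product topology and $\mathbb{P}=p^{\mathbb{N}}$ the product measure. $\operatorname{Diam}(A)=\sup\{d(x,y):x,y\in A\}$. $T_p$ acts on Borel probability measures on $X$ by $T_p(\mu)(B)=\int_\Lambda\mu(\omega_\lambda^{-1}(B))\,dp(\lambda)$; under the hypotheses it has a unique fixed point $\mu_p$. *)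

(* Defs.v *)
From HB Require Import structures.
From mathcomp Require Import all_boot all_order all_algebra.
From mathcomp Require Import all_classical all_reals all_analysis.
Set Implicit Arguments. Unset Strict Implicit. Unset Printing Implicit Defensive.
Import Order.TTheory GRing.Theory Num.Theory numFieldNormedType.Exports.
Local Open Scope classical_set_scope.
Local Open Scope ring_scope.

(* Metric spaces with a distinguished point (needed only because the library's
   generated sigma-algebra construction requires a pointed carrier; both X and
   Lambda are nonempty in the theorem, so this is no restriction). *)
#[short(type="pmetricType")]
HB.structure Definition PMetric (K : numDomainType) :=
  { M of Metric K M & isPointed M }.

Definition Borel (T : ptopologicalType) := g_sigma_algebraType (@open T).

Definition cylinders (T : ptopologicalType) : set (set (nat -> T)) :=
  [set C | exists n A, @measurable _ (Borel T) A /\ C = [set s | A (s n)]].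
Definition Omega (T : ptopologicalType) := g_sigma_algebraType (@cylinders T).

Definition is_product_measure (R : realType) (T : ptopologicalType)
  (p : probability (Borel T) R) (P : probability (Omega T) R) : Prop :=
  forall (n : nat) (A : nat -> set T),
    (forall i, @measurable _ (Borel T) (A i)) ->
    P [set s : nat -> T | forall i, (i < n)%N -> A i (s i)] =
      (\prod_(i < n) fine (p (A i)))%:E.

Definition Diam (R : realType) (X : metricType R) (A : set X) : R :=
  sup [set mdist a b | a in A & b in A].

(* backward composition  w_{s_1} o ... o w_{s_n}  (s_1 = s 0) *)
Fixpoint bcomp (L X : Type) (om : L -> X -> X) (s : nat -> L) (n : nat) (y : X) : X :=
  match n with
  | 0 => y
  | n'.+1 => bcomp om s n' (om (s n') y)
  end.

Fixpoint fcomp (L X : Type) (om : L -> X -> X) (s : nat -> L) (n : nat) (x : X) : X :=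
  match n with
  | 0 => x
  | n'.+1 => om (s n') (fcomp om s n' x)
  end.

Definition weakly_hyp_seq (R : realType) (L : Type) (X : metricType R)
  (om : L -> X -> X) (s : nat -> L) : Prop :=
  (fun n => Diam (range (bcomp om s n))) @ \oo --> (0 : R).

(* Main.v *)
Require Import Defs.
From HB Require Import structures.
From mathcomp Require Import all_boot all_order all_algebra.
From mathcomp Require Import all_classical all_reals all_analysis.
From mathcomp Require Import measurable_realfun.
From mathcomp Require Import ring lra zify.
Import Order.TTheory GRing.Theory Num.Theory numFieldNormedType.Exports.
Local Open Scope classical_set_scope.
Local Open Scope ring_scope.

(* Let [T g x] be the integral of [g (w_l x)] in [p(dl)], and [X_j] the random
   orbit of [x]. The variables [g X_{j+1} - T g X_j] are bounded and pairwise
   orthogonal, so their averages tend to 0 almost surely; hence the averages of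
   [g X_j] and of [T g X_j] have the same limit, and so, for every [k], do those
   of [f X_j] and of [T^k f X_j]. Moreover [T^k f x] is the expectation of [f]
   at the backward composition of length [k] started at [x]; by weak
   hyperbolicity and dominated convergence the oscillation of [T^k f] tends to 0. As [mu] is
   stationary, [T^k f] has the same [mu]-integral as [f], so [T^k f] tends
   uniformly to the constant [int f dmu]. *)

Set Implicit Arguments.
Unset Strict Implicit.
Unset Printing Implicit Defensive.

(** * Bounded measurable functions and their integrals *)

Section bounded_measurable.
Context {R : realType}.

(** Closed under the operations below and integrable for every probability, this class settles most
    integrability side conditions of the proof. *)
Definition bounded_measurable d (T : measurableType d) (f : T -> R) : Prop :=
  measurable_fun [set: T] f /\ exists M : R, forall x, `|f x| <= M.

Context d (T : measurableType d).
Implicit Types f g : T -> R.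

Lemma bounded_measurable_cst (c : R) : bounded_measurable (fun _ : T => c).
Proof. by split; [exact: measurable_cst|exists `|c|]. Qed.

Lemma bounded_measurableD f g : bounded_measurable f -> bounded_measurable g ->
  bounded_measurable (fun x => f x + g x).
Proof.
move=> [mf [M fM]] [mg [N gN]]; split; first exact: measurable_funD.
by exists (M + N) => x; rewrite (le_trans (ler_normD _ _))// lerD.
Qed.

Lemma bounded_measurableN f : bounded_measurable f ->
  bounded_measurable (fun x => - f x).
Proof.
move=> [mf [M fM]]; split; last by exists M => x; rewrite normrN.
exact: measurableT_comp.
Qed.

Lemma bounded_measurableB f g : bounded_measurable f -> bounded_measurable g ->
  bounded_measurable (fun x => f x - g x).
Proof. by move=> bf bg; apply: bounded_measurableD bf _;
  exact: bounded_measurableN. Qed.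

Lemma bounded_measurableM f g : bounded_measurable f -> bounded_measurable g ->
  bounded_measurable (fun x => f x * g x).
Proof.
move=> [mf [M fM]] [mg [N gN]]; split; first exact: measurable_funM.
by exists (M * N) => x; rewrite normrM ler_pM.
Qed.

Lemma bounded_measurable_sum (F : nat -> T -> R) n :
  (forall i, bounded_measurable (F i)) ->
  bounded_measurable (fun x => \sum_(0 <= i < n) F i x).
Proof.
move=> bF; elim: n => [|n IH].
  under eq_fun do rewrite big_geq//; exact: bounded_measurable_cst.
under eq_fun do rewrite big_nat_recr//=.
exact: bounded_measurableD.
Qed.

Lemma bounded_measurable_norm f : bounded_measurable f ->
  bounded_measurable (fun x => `|f x|).
Proof.
move=> [mf [M fM]]; split; last by exists M => x; rewrite normr_id.
exact: measurableT_comp.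
Qed.

Lemma bounded_measurable_comp d' (T' : measurableType d') (h : T' -> T) f :
  measurable_fun [set: T'] h -> bounded_measurable f ->
  bounded_measurable (f \o h).
Proof.
move=> mh [mf [M fM]]; split; last by exists M => x /=.
exact: measurableT_comp.
Qed.

Variable mu : probability T R.

Lemma bounded_measurable_integrable f : bounded_measurable f ->
  mu.-integrable [set: T] (EFin \o f).
Proof.
move=> [mf [M fM]]; apply: measurable_bounded_integrable => //.
  by apply: fin_num_fun_lty; exact: fin_num_measure.
exists M; split; first exact: num_real.
by move=> N MN x _ /=; rewrite (le_trans (fM x))// ltW.
Qed.

Lemma bounded_measurable_integralE f : bounded_measurable f ->
  (\int[mu]_x (f x)%:E)%E = (\int[mu]_x f x)%:E.
Proof.
move=> bf; rewrite /Rintegral fineK//.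
exact: integrable_fin_num (bounded_measurable_integrable bf).
Qed.

Lemma Rintegral_norm_le f (M : R) : bounded_measurable f ->
  (forall x, `|f x| <= M) -> `|\int[mu]_x f x| <= M.
Proof.
move=> bf fM; rewrite (le_trans (le_normr_Rintegral _ _))//.
  exact: bounded_measurable_integrable.
have -> : M = \int[mu]_(x in [set: T]) M.
  by rewrite Rintegral_cst//= probability_setT mulr1.
apply: le_Rintegral => //.
- exact/bounded_measurable_integrable/bounded_measurable_norm.
- exact/bounded_measurable_integrable/bounded_measurable_cst.
Qed.

End bounded_measurable.

(** * Fubini's theorem for bounded functions *)

Section fubini.
Context {R : realType} d1 d2 (T1 : measurableType d1) (T2 : measurableType d2).
Variables (m1 : probability T1 R) (m2 : probability T2 R).

Lemma bounded_measurable_pair1 (f : T1 * T2 -> R) x :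
  bounded_measurable f -> bounded_measurable (fun y => f (x, y)).
Proof. by apply: bounded_measurable_comp; exact: pair1_measurable. Qed.

Lemma bounded_measurable_pair2 (f : T1 * T2 -> R) y :
  bounded_measurable f -> bounded_measurable (fun x => f (x, y)).
Proof.
by apply: (@bounded_measurable_comp _ _ _ _ _ (fun x => (x, y)));
  exact: pair2_measurable.
Qed.

Lemma bounded_measurable_Rintegral (f : T1 * T2 -> R) :
  bounded_measurable f ->
  bounded_measurable (fun y => \int[m1]_x f (x, y)).
Proof.
move=> bf; split; last first.
  have [_ [M fM]] := bf.
  by exists M => y; apply: Rintegral_norm_le => //;
    exact: bounded_measurable_pair2.
(* Measurability in [y] comes from Fubini's theorem: [f] is bounded, hence integrable for
   [m1 \x m2]. *)
apply: (measurableT_comp (fine_measurable measurableT)).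
apply: (@measurable_fubini_G _ _ _ _ _ m1 m2 (EFin \o f)).
exact: (@bounded_measurable_integrable _ _ _ (m1 \x m2)%E).
Qed.

Lemma Rintegral_prod1 (f : T1 * T2 -> R) : bounded_measurable f ->
  \int[(m1 \x m2)%E]_z f z = \int[m1]_x \int[m2]_y f (x, y).
Proof.
move=> bf; rewrite /Rintegral -integral12_prod_meas1; last first.
  exact: (@bounded_measurable_integrable _ _ _ (m1 \x m2)%E).
congr fine; apply: eq_integral => x _; rewrite /fubini_F /=.
by apply: bounded_measurable_integralE; exact: bounded_measurable_pair1.
Qed.

Lemma Rintegral_prod2 (f : T1 * T2 -> R) : bounded_measurable f ->
  \int[(m1 \x m2)%E]_z f z = \int[m2]_y \int[m1]_x f (x, y).
Proof.
move=> bf; rewrite /Rintegral -integral21_prod_meas1; last first.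
  exact: (@bounded_measurable_integrable _ _ _ (m1 \x m2)%E).
congr fine; apply: eq_integral => x _; rewrite /fubini_G /=.
by apply: bounded_measurable_integralE; exact: bounded_measurable_pair2.
Qed.

End fubini.

(** * Change of variables *)

Section pushforward.
Context {R : realType} d1 d2 (T1 : measurableType d1) (T2 : measurableType d2).
Variables (m1 : probability T1 R) (m2 : probability T2 R) (phi : T1 -> T2).

(** Taking [m2] as a given measure with prescribed values covers both later uses: the invariance of
    [P] under resampling and the stationarity of [mu]. *)
Lemma Rintegral_eq_pushforward (f : T2 -> R) :
  measurable_fun [set: T1] phi ->
  (forall A, measurable A -> m2 A = m1 (phi @^-1` A)) ->
  bounded_measurable f ->
  \int[m2]_y f y = \int[m1]_x f (phi x).
Proof.
move=> mphi m2E bf; rewrite /Rintegral; congr fine.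
rewrite (eq_measure_integral (pushforward m1 phi)); last by move=> A mA _;
  exact: m2E.
rewrite integral_pushforward//.
  by apply/measurable_EFinP; exact: bf.1.
apply: (@bounded_measurable_integrable _ _ _ m1 (f \o phi)).
exact: bounded_measurable_comp.
Qed.

End pushforward.

(** * A strong law for bounded orthogonal variables *)

Section slln.
Context {R : realType}.

(** Telescoping of [(x + 1) ^- 2 <= x^-1 - (x + 1)^-1]; the induction carries the sharper bound
    [2 - n.+1%:R^-1]. *)
Lemma sum_inv_sqr_le (n : nat) :
  \sum_(0 <= k < n) (k.+1%:R ^- 2 : R) <= 2.
Proof.
case: n => [|n]; first by rewrite big_geq.
suff : \sum_(0 <= k < n.+1) (k.+1%:R ^- 2 : R) <= 2 - n.+1%:R^-1.
  by move=> /le_trans; apply; rewrite gerBl.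
elim: n => [|n IH]; first by rewrite big_nat1 expr1n invr1; lra.
rewrite big_nat_recr//= (le_trans (lerD IH (lexx _)))//.
have n0 : 0 < n.+1%:R :> R by [].
rewrite -[n.+2]addn1 natrD; move: n0; set x : R := n.+1%:R => n0.
have : (x + 1) ^- 2 <= x^-1 - (x + 1)^-1.
  have -> : x^-1 - (x + 1)^-1 = (x * (x + 1))^-1.
    by field; rewrite !gt_eqF// addr_gt0.
  by rewrite lef_pV2 ?posrE ?mulr_gt0 ?exprn_gt0 ?addr_gt0// expr2; nra.
by move: ((x + 1) ^- 2) (x + 1)^-1 x^-1 => a b c; lra.
Qed.

(** Beyond the last square (k+1)^2 below n+1 there are only O(k) terms, each bounded by [C], which
    is negligible against n+1 >= (k+1)^2. *)
Lemma cesaro_from_squares (u : nat -> R) (C : R) :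
  (forall i, `|u i| <= C) ->
  (fun k => (((k.+1 ^ 2)%:R^-1) * \sum_(0 <= i < k.+1 ^ 2) u i) ^+ 2) @ \oo -->
    (0:R) ->
  (fun n => n.+1%:R^-1 * \sum_(0 <= i < n.+1) u i) @ \oo --> (0:R).
Proof.
move=> uC /cvgrPdist_lt sq; apply/cvgrPdist_le => e e0.
have C0 : 0 <= C by exact: le_trans (uC 0%N).
have e2 : 0 < e / 2 by rewrite divr_gt0.
have [K _ HK] := sq _ (exprn_gt0 2 e2).
(* [K] makes the average over a square less than [e / 2]; [6 * C / e] makes the at most [3 * k.+1]
   remaining terms contribute at most [e / 2]. *)
pose K2 := (K + Num.truncn (6 * C / e))%N.
exists (K2.+1 ^ 2)%N => // n /= Kn.
rewrite sub0r normrN.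
have [k [kn nk]] : exists k, (k.+1 ^ 2 <= n.+1)%N /\ (n.+1 < k.+2 ^ 2)%N.
  have ex0 : exists k, (k.+1 ^ 2 <= n.+1)%N by exists 0%N.
  have ub k : (k.+1 ^ 2 <= n.+1)%N -> (k <= n)%N by rewrite -mulnn; nia.
  have [k kn kmax] := ex_maxnP ex0 ub.
  by exists k; split => //; rewrite ltnNge; apply/negP => /kmax; rewrite ltnn.
have K2k : (K2 <= k)%N by rewrite -!mulnn in Kn nk; nia.
have {HK} := HK k (leq_trans (leq_addr _ _) K2k).
rewrite sub0r normrN normrX ltr_pXn2r ?nnegrE ?normr_ge0 ?(ltW e2)// normrM
  normfV normr_nat => Sm.
have k1 : 0 < k.+1%:R :> R by [].
have m0 : 0 < (k.+1 ^ 2)%:R :> R by rewrite ltr0n expn_gt0.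
rewrite mulrC ltr_pdivrMr// in Sm.
rewrite normrM normfV normr_nat mulrC ler_pdivrMr//.
rewrite (@big_cat_nat _ _ _ (k.+1 ^ 2))//= (le_trans (ler_normD _ _))//.
have rest : `|\sum_(k.+1 ^ 2 <= i < n.+1) u i| <= C * (n.+1 - k.+1 ^ 2)%:R.
  rewrite (le_trans (ler_norm_sum _ _ _))//.
  by rewrite (le_trans (ler_sum _ (fun i _ =>
    uC i)))// sumr_const_nat mulr_natr.
(* Since (k+2)^2 - (k+1)^2 = 2k + 3 and [nk] is strict, at most 2k + 2 terms remain. *)
have gap : (n.+1 - k.+1 ^ 2)%:R <= 3 * k.+1%:R :> R.
  by rewrite -natrM ler_nat; rewrite -!mulnn in kn nk *; nia.
have kC : 6 * C <= e * k.+1%:R.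
  rewrite mulrC -ler_pdivrMl// mulrC; apply: (le_trans (ltW (truncnS_gt _))).
  by rewrite ler_nat ltnS; apply: leq_trans K2k;
    rewrite /K2 [e^-1 * _]mulrC leq_addl.
have MN : (k.+1 ^ 2)%:R <= n.+1%:R :> R by rewrite ler_nat.
have ME : (k.+1 ^ 2)%:R = k.+1%:R * k.+1%:R :> R by rewrite -natrM mulnn.
have Cgap : C * (n.+1 - k.+1 ^ 2)%:R <= C * (3 * k.+1%:R) by rewrite ler_wpM2l.
have kCk : 6 * C * k.+1%:R <= e * k.+1%:R * k.+1%:R by rewrite ler_wpM2r// ltW.
have eMN : e * (k.+1 ^ 2)%:R <= e * n.+1%:R by rewrite ler_wpM2l// ltW.
rewrite ME in Sm eMN; lra.
Qed.

Section orthogonal.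
Context d (T : measurableType d) (P : probability T R).
Variables (D : nat -> T -> R) (C : R).
Hypothesis mD : forall i, measurable_fun [set: T] (D i).
Hypothesis DC : forall i x, `|D i x| <= C.
Hypothesis orthoD : forall i j, (i < j)%N -> \int[P]_x (D i x * D j x) = 0.

Let S n x := \sum_(0 <= i < n) D i x.

Let bD i : bounded_measurable (D i).
Proof. by split => //; exists C. Qed.

Let bS n : bounded_measurable (S n).
Proof. exact: bounded_measurable_sum. Qed.

Let orthoS k n : (k <= n)%N -> \int[P]_x (S k x * D n x) = 0.
Proof.
elim: k => [_|k IH kn].
  under eq_Rintegral do rewrite /S big_geq// mul0r.
  by rewrite Rintegral_cst// mul0r.
under eq_Rintegral do rewrite /S big_nat_recr//= mulrDl.
rewrite RintegralD//; last 2 first.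
- by apply: bounded_measurable_integrable;
    exact: bounded_measurableM (bS k) (bD n).
- by apply: bounded_measurable_integrable;
    exact: bounded_measurableM (bD k) (bD n).
by rewrite IH ?(ltnW kn)// orthoD// addr0.
Qed.

(** The cross terms vanish by [orthoS], so only the [n] second moments of the [D i] remain, each at
    most [C ^+ 2]. *)
Lemma orthogonal_second_moment n : \int[P]_x (S n x ^+ 2) <= n%:R * C ^+ 2.
Proof.
elim: n => [|n IH].
  under eq_Rintegral do rewrite /S big_geq// expr2 mul0r.
  by rewrite Rintegral_cst// !mul0r.
have -> : \int[P]_x (S n.+1 x ^+ 2) =
    \int[P]_x (S n x ^+ 2) + \int[P]_x (D n x * D n x).
  have bSS := bounded_measurableM (bS n) (bS n).
  have bSD := bounded_measurableM (bS n) (bD n).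
  have bDD := bounded_measurableM (bD n) (bD n).
  have -> : \int[P]_x (S n.+1 x ^+ 2) =
      \int[P]_x (S n x * S n x + (S n x * D n x + (S n x * D n x + D n x * D n
        x))).
    apply: eq_Rintegral => x _; rewrite /S big_nat_recr//=; ring.
  have b1 := bounded_measurableD bSD bDD; have b2 := bounded_measurableD bSD b1.
  rewrite !RintegralD//; try exact: bounded_measurable_integrable.
  by rewrite orthoS// !add0r; under [in RHS]eq_Rintegral do rewrite expr2.
rewrite -natr1 mulrDl mul1r lerD//.
apply: le_trans (ler_norm _) _; apply: Rintegral_norm_le.
  exact: bounded_measurableM.
by move=> x; rewrite normrM expr2 ler_pM.
Qed.

(* The averages over the squares [(k+1)^2] have summable second moments, so they
   tend to 0 almost surely; boundedness fills the gaps between squares. *)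
Lemma orthogonal_slln : {ae P, forall x,
  (fun n => n.+1%:R^-1 * \sum_(0 <= i < n.+1) D i x) @ \oo --> (0:R)}.
Proof.
pose Y k x := (((k.+1 ^ 2)%:R^-1) * S (k.+1 ^ 2) x) ^+ 2.
have bY k : bounded_measurable (Y k).
  rewrite /Y; under eq_fun do rewrite expr2.
  by do 2?apply: bounded_measurableM => //; exact: bounded_measurable_cst.
have Y0 k x : 0 <= Y k x by rewrite /Y sqr_ge0.
(* With m = (k+1)^2 terms, the second moment m C^2 is divided by m^2. *)
have EY k : \int[P]_x Y k x <= C ^+ 2 * k.+1%:R ^- 2.
  rewrite /Y; under eq_Rintegral do rewrite exprMn.
  rewrite RintegralZl//; last first.
    apply: bounded_measurable_integrable; under eq_fun do rewrite expr2.
    exact: bounded_measurableM.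
  have m0 : 0 < (k.+1 ^ 2)%:R :> R by rewrite ltr0n expn_gt0.
  apply: le_trans (ler_wpM2l _ (orthogonal_second_moment _)) _;
    first exact: sqr_ge0.
  rewrite mulrA expr2 mulrVK ?unitfE ?gt_eqF// mulrC.
  by rewrite natrX.
have mY k : measurable_fun [set: T] (EFin \o Y k) by apply/measurable_EFinP;
  exact: (bY k).1.
(* The [Y k] are nonnegative, so integral and series commute; a series with finite expectation is
   finite almost everywhere. *)
have intY : (\int[P]_x (\sum_(0 <= k <oo) (Y k x)%:E) <= (2 * C ^+ 2)%:E)%E.
  rewrite integral_nneseries//; last by move=> *; rewrite lee_fin.
  apply: lime_le; first by apply: is_cvg_nneseries => k _ _;
    apply: integral_ge0 => x _; rewrite lee_fin.
  apply: nearW => n.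
  under eq_bigr do rewrite bounded_measurable_integralE//.
  rewrite sumEFin lee_fin (le_trans (ler_sum _ (fun i _ => EY i)))//.
  by rewrite -mulr_sumr mulrC ler_wpM2r ?sqr_ge0// sum_inv_sqr_le.
have : P.-integrable [set: T] (fun x => \sum_(0 <= k <oo) (Y k x)%:E)%E.
  apply/integrableP; split.
    apply: (@ge0_emeasurable_sum _ _ _ _ (fun k x => (Y k x)%:E) xpredT) =>
      [k x _ _|k _].
      by rewrite lee_fin.
    exact: mY.
  rewrite (eq_integral (fun x => \sum_(0 <= k <oo) (Y k x)%:E)%E); last first.
    by move=> x _; rewrite gee0_abs// nneseries_ge0// => k _ _; rewrite lee_fin.
  exact: le_lt_trans intY (ltry _).
move=> /(integrable_ae measurableT); apply: filterS => x /(_ I) fY.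
apply: (@cesaro_from_squares (D ^~ x) C) => [i|]; first exact: DC.
have YE0 k : (0 <= (Y k x)%:E)%E by rewrite lee_fin.
have fY' : (\sum_(0 <= k <oo) (Y k x)%:E < +oo)%E by move: fY;
  rewrite fin_numE => /andP[_]; rewrite ltey.
(* The term [Y k x] lies between 0 and the tail starting at [k] of a convergent series. *)
have tail := nneseries_tail_cvg (P := xpredT) fY' (fun k _ => YE0 k).
suff : (fun k => (Y k x)%:E) @ \oo --> 0%E by move/fine_cvg.
apply: squeeze_cvge (cvg_cst 0%E) tail; apply: nearW => k.
rewrite YE0/= (nneseries_split k 1)// addn1 big_nat1 leeDl// nneseries_ge0//.
Qed.

End orthogonal.
End slln.

(** * Borel sets and continuous maps on second countable products *)

Section borel.

Lemma measurable_open (Z : ptopologicalType) (U : set Z) :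
  open U -> @measurable _ (Borel Z) U.
Proof. exact: sub_sigma_algebra. Qed.

Lemma measurable_fun_borel d (T : measurableType d) (Z : ptopologicalType)
    (g : T -> Z) :
  (forall U, open U -> measurable (g @^-1` U)) ->
  measurable_fun [set: T] (g : T -> Borel Z).
Proof.
move=> mg; apply: (@measurability _ _ T (Borel Z) setT g (@open Z)) => //.
by move=> _ [U oU <-]; rewrite setTI; exact: mg.
Qed.

Lemma measurable_fun_continuous_real (R : realType) (Z : ptopologicalType)
  (f : Z -> R) : continuous f -> measurable_fun [set: Borel Z] f.
Proof.
move=> cf; apply: (measurability _ (RGenOInfty.measurableE R)).
move=> _ [_ [a ->] <-]; rewrite setTI; apply: measurable_open.
by move/continuousP : cf; apply; exact: interval_open.
Qed.

(** [W] is the union of the basic open rectangles that it contains, and second countability of both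
    factors leaves only countably many of them. *)
Lemma measurable_open_prod (Y Z : ptopologicalType) (W : set (Y * Z)) :
  @second_countable Y -> @second_countable Z -> open W ->
  @measurable _ (Borel Y * Borel Z)%type W.
Proof.
move=> [B cB [oB bB]] [C cC [oC bC]] oW.
pose D := [set z : set Y * set Z | [/\ B z.1, C z.2 & z.1 `*` z.2 `<=` W]].
have cD : countable D.
  apply: sub_countable (countableX cB cC).
  by apply: subset_card_le => -[b c] [/= Bb Cc _].
have -> : W = \bigcup_(z : D) ((val z).1 `*` (val z).2).
  rewrite -(bigcup_set_type D (fun z => z.1 `*` z.2)).
  apply/seteqP; split => [[y z] Wyz|yz [bc [_ _ bcW] ]]; last exact: bcW.
  have : nbhs (y, z) W by exact: open_nbhs_nbhs.
  move=> [[U V] /= [Uy Vz] UVW].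
  have [b [Bb yb] bU] := bB y U Uy.
  have [c [Cc zc] cV] := bC z V Vz.
  exists (b, c) => //; split => // -[y' z'] [/= yb' zc'].
  by apply: UVW; split; [exact: bU|exact: cV].
apply: countable_bigcupT_measurable.
  by rewrite (eq_countable (card_setT _)).
move=> [[b c] /=]; rewrite inE => -[/= Bb Cc _].
apply: measurableX; apply: measurable_open; [exact: oB|exact: oC].
Qed.

Lemma measurable_fun_continuous_prod (Y Z V : ptopologicalType) (g : Y * Z ->
  V) :
  @second_countable Y -> @second_countable Z -> continuous g ->
  measurable_fun [set: Borel Y * Borel Z] (g : _ -> Borel V).
Proof.
move=> cY cZ cg; apply: measurable_fun_borel => U oU.
by apply: measurable_open_prod => //; move/continuousP : cg; exact.
Qed.

End borel.

(** * The product measure and the resampling of one coordinate *)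

Section product_space.
Context {R : realType} (L : ptopologicalType).

Lemma measurable_coordinate n :
  measurable_fun [set: Omega L] (fun s : Omega L => s n : Borel L).
Proof.
move=> _ A mA; rewrite setTI; apply: sub_sigma_algebra.
by exists n, A.
Qed.

Lemma measurable_fun_Omega d (T : measurableType d) (g : T -> nat -> L) :
  (forall n, measurable_fun [set: T] (fun t => g t n : Borel L)) ->
  measurable_fun [set: T] (g : T -> Omega L).
Proof.
move=> mg; apply: (@measurability _ _ T (Omega L) setT g (@cylinders L)) => //.
move=> _ [_ [n [A [mA ->]]] <-]; exact: mg.
Qed.

Definition resample (j : nat) (s : nat -> L) (l : L) : nat -> L :=
  fun i => if i == j then l else s i.

Lemma measurable_resample j :
  measurable_fun [set: Omega L * Borel L]
    (fun z => resample j z.1 z.2 : Omega L).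
Proof.
apply: measurable_fun_Omega => n; rewrite /resample.
case: eqP => _; first exact: measurable_snd.
exact: (measurableT_comp (measurable_coordinate n) measurable_fst).
Qed.

(** The pi-system on which [is_product_measure] prescribes [P]. The single-coordinate [cylinders]
    generate the same sigma-algebra but are in general not closed under intersection. *)
Definition boxes : set (set (nat -> L)) :=
  [set E | exists n A, (forall i : nat, @measurable _ (Borel L) (A i)) /\
    E = [set s | forall i, (i < n)%N -> A i (s i)]].

Lemma boxes_setI : setI_closed boxes.
Proof.
move=> _ _ [m [A [mA ->]]] [n [B [mB ->]]].
(* Both boxes are padded with [setT] to the common length [maxn m n]. *)
pose cut k (F : nat -> set L) i := if (i < k)%N then F i else setT.
exists (maxn m n), (fun i => cut m A i `&` cut n B i); split.
  by move=> i; apply: measurableI; rewrite /cut; case: ifP => // _;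
    exact: measurableT.
apply/seteqP; split => [s [sA sB] i _|s sAB].
  by rewrite /cut; split; case: ifP => // im; [exact: sA|exact: sB].
split=> i im.
  by have := sAB i; rewrite leq_max im /cut im => /(_ isT)[].
by have := sAB i; rewrite leq_max im orbT /cut im => /(_ isT)[].
Qed.

Lemma measurable_box n (A : nat -> set L) :
  (forall i : nat, @measurable _ (Borel L) (A i)) ->
  @measurable _ (Omega L) [set s | forall i, (i < n)%N -> A i (s i)].
Proof.
move=> mA.
have -> : [set s : Omega L | forall i, (i < n)%N -> A i (s i)] =
    \bigcap_(i in [set i | (i < n)%N]) [set s | A i (s i)] by [].
apply: bigcap_measurableType => // i _.
by have := measurable_coordinate i measurableT (mA i); rewrite setTI.
Qed.

Lemma measurable_boxesE : @measurable _ (Omega L) = <<s boxes >>.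
Proof.
apply/seteqP; split; apply: smallest_sub.
- exact: smallest_sigma_algebra.
- move=> _ [n [A [mA ->]]]; apply: sub_sigma_algebra.
  exists n.+1, (fun i => if i == n then A else setT); split.
    by move=> i; case: ifP => // _; exact: measurableT.
  apply/seteqP; split => [s As i _|s /(_ n)]; last by rewrite eqxx; exact.
  by case: eqP => // ->.
- exact: smallest_sigma_algebra.
- by move=> _ [n [A [mA ->]]]; exact: measurable_box.
Qed.

Variables (p : probability (Borel L) R) (P : probability (Omega L) R).
Hypothesis hP : is_product_measure p P.

(* Overwriting coordinate [j] with an independent copy preserves [P]; every use
   of the independence of the coordinates goes through this. *)
Lemma resample_invariant j (E : set (Omega L)) : measurable E ->
  P E = (P \x p)%E ((fun z => resample j z.1 z.2) @^-1` E).
Proof.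
pose phi (z : Omega L * Borel L) : Omega L := resample j z.1 z.2.
have mphi : measurable_fun setT phi by exact: measurable_resample.
move=> mE; rewrite -[RHS]/(pushforward (P \x p)%E phi E).
unshelve epose (Q := pushforward (P \x p)%E phi : measure (Omega L) R);
  first exact: mphi.
rewrite -[RHS]/(Q E).
(* Finite measures that agree on the generating pi-system [boxes] are equal. *)
apply: (@measure_unique _ R (Omega L) boxes (fun _ =>
  setT) measurable_boxesE boxes_setI _ _ P Q) => //.
- by move=> _; exists 0%N, (fun _ => setT); split; [move=> i;
    exact: measurableT|apply/seteqP; split].
- by rewrite bigcup_const.
- move=> _ [n [A [mA ->]]].
  (* The preimage of a box is a rectangle: the constraint on coordinate [j] moves from the sequence
     to the fresh letter, and is void when [j >= n]. *)
  pose A' i := if i == j then setT else A i.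
  pose Aj := if (j < n)%N then A j else setT.
  have mA' i : @measurable _ (Borel L) (A' i).
    by rewrite /A'; case: ifP => // _; exact: measurableT.
  have mAj : @measurable _ (Borel L) Aj.
    by rewrite /Aj; case: ifP => // _; exact: measurableT.
  rewrite -[RHS]/((P \x p)%E (phi @^-1` [set s | forall i, (i < n)%N -> A i (s
    i)])).
  have -> : phi @^-1` [set s | forall i, (i < n)%N -> A i (s i)] =
      [set s | forall i, (i < n)%N -> A' i (s i)] `*` Aj.
    apply/seteqP; split => [[s l]|[s l] [/= sA lA] i im].
      rewrite /phi /resample /= => sA; split => /= [i im|].
        by rewrite /A'; have := sA i im; case: eqP.
      by rewrite /Aj; case: ifP => // jn; have := sA j jn; rewrite eqxx.
    rewrite /phi /resample /=; have := sA i im; rewrite /A'; case: eqP =>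
      // ij _.
    by move: lA; rewrite /Aj -ij im.
  rewrite product_measure1E//; last exact: measurable_box.
  have PA' := hP n mA'.
  apply: (eq_trans (hP n mA)); apply/esym.
  apply: (eq_trans (congr1 (fun a => a * p Aj)%E PA')).
  have pT : p setT = 1%E by exact: probability_setT.
  have pAj : p Aj = (fine (p Aj))%:E by rewrite fineK// fin_num_measure.
  rewrite pAj -EFinM; congr EFin; rewrite /Aj; case: ltnP => [jn|nj].
    rewrite [X in X * _ = _](bigD1 (Ordinal jn))//= [RHS](bigD1 (Ordinal
      jn))//= {1}/A' eqxx pT mul1r mulrC; congr (_ * _).
    apply: eq_bigr => i; rewrite /A' => ij.
    by case: eqP => // ij'; case/eqP: ij; exact: val_inj.
  rewrite pT mulr1; apply: eq_bigr => i _; rewrite /A'.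
  by case: eqP => // ij; have := ltn_ord i; rewrite ij ltnNge nj.
- by move=> _; apply: fin_num_fun_lty; exact: fin_num_measure.
Qed.

(** Integrating the letter [j] first, with the others frozen, plays the role of a conditional
    expectation; it yields the orthogonality of the increments. *)
Lemma Rintegral_resample j (H : Omega L -> R) : bounded_measurable H ->
  \int[P]_s H s = \int[P]_s \int[p]_l H (resample j s l).
Proof.
move=> bH; have mr := measurable_resample j.
rewrite (Rintegral_eq_pushforward (m1 := (P \x p)%E) mr (resample_invariant
  j))//.
by rewrite Rintegral_prod1//; exact: (bounded_measurable_comp mr).
Qed.

(** The opposite order keeps the letter [j] outside, as needed to peel one letter off a
    composition. *)
Lemma Rintegral_resample_swap j (H : Omega L -> R) : bounded_measurable H ->
  \int[P]_s H s = \int[p]_l \int[P]_s H (resample j s l).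
Proof.
move=> bH; have mr := measurable_resample j.
rewrite (Rintegral_eq_pushforward (m1 := (P \x p)%E) mr (resample_invariant
  j))//.
by rewrite Rintegral_prod2//; exact: (bounded_measurable_comp mr).
Qed.

End product_space.

(** * Random orbits and the transfer operator *)

Section random_iteration.
Context {R : realType} (X L : ptopologicalType) (om : L -> X -> X).
Hypothesis mom :
  measurable_fun [set: Borel L * Borel X] (fun z => om z.1 z.2 : Borel X).

Lemma eq_fcomp (s t : nat -> L) n x :
  (forall i, (i < n)%N -> s i = t i) -> fcomp om s n x = fcomp om t n x.
Proof.
elim: n => //= n IH st; rewrite st// IH// => i /ltnW; exact: st.
Qed.

Lemma eq_bcomp (s t : nat -> L) n x :
  (forall i, (i < n)%N -> s i = t i) -> bcomp om s n x = bcomp om t n x.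
Proof.
elim: n x => //= n IH x st; rewrite st// IH// => i /ltnW; exact: st.
Qed.

Lemma resample_lt j (s : nat -> L) l i : (i < j)%N -> resample j s l i = s i.
Proof. by rewrite /resample; case: eqP => // ->; rewrite ltnn. Qed.

Lemma resample_id j (s : nat -> L) l : resample j s l j = l.
Proof. by rewrite /resample eqxx. Qed.

Lemma fcomp_resample j (s : nat -> L) l n x : (n <= j)%N ->
  fcomp om (resample j s l) n x = fcomp om s n x.
Proof.
by move=> nj; apply: eq_fcomp => i /leq_trans /(_ nj); exact: resample_lt.
Qed.

Lemma bcomp_resample j (s : nat -> L) l n x : (n <= j)%N ->
  bcomp om (resample j s l) n x = bcomp om s n x.
Proof.
by move=> nj; apply: eq_bcomp => i /leq_trans /(_ nj); exact: resample_lt.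
Qed.

Lemma measurable_fcomp n x :
  measurable_fun [set: Omega L] (fun s : Omega L => fcomp om s n x : Borel X).
Proof.
elim: n => [|n IH]; first exact: measurable_cst.
exact: (measurableT_comp mom (measurable_fun_pair (measurable_coordinate (L :=
  L) n) IH)).
Qed.

Lemma measurable_bcomp n :
  measurable_fun [set: Omega L * Borel X]
    (fun z => bcomp om z.1 n z.2 : Borel X).
Proof.
elim: n => [|n IH]; first exact: measurable_snd.
have ms := measurableT_comp (measurable_coordinate (L := L) n)
  (measurable_fst : measurable_fun [set: Omega L * Borel X] fst).
have mo := measurableT_comp mom (measurable_fun_pair ms measurable_snd).
exact: (measurableT_comp IH (measurable_fun_pair measurable_fst mo)).
Qed.

Variables (p : probability (Borel L) R) (mu : probability (Borel X) R).

(** The Markov operator on functions that is dual to [T_p] on measures. *)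
Definition transfer (g : X -> R) (x : X) : R := \int[p]_l g (om l x).

Lemma bounded_measurable_om (g : Borel X -> R) : bounded_measurable g ->
  bounded_measurable (fun z : Borel L * Borel X => g (om z.1 z.2)).
Proof. by move=> bg; exact: (bounded_measurable_comp mom bg). Qed.

Lemma bounded_measurable_transfer (g : Borel X -> R) : bounded_measurable g ->
  bounded_measurable (transfer g : Borel X -> R).
Proof.
by move=> /bounded_measurable_om; exact: (bounded_measurable_Rintegral p mu).
Qed.

Lemma bounded_measurable_iter_transfer (g : Borel X -> R) k :
  bounded_measurable g ->
  bounded_measurable (iter k transfer g : Borel X -> R).
Proof. by move=> bg; elim: k => //= k IH;
  exact: bounded_measurable_transfer. Qed.

Section stationary.
Hypothesis hmu : forall B : set X, @measurable _ (Borel X) B ->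
  mu B = (\int[p]_(l in [set: Borel L]) mu (om l @^-1` B))%E.

(** The fixed-point equation says that [mu] is the image of [p \x mu] under [(l, y) |-> om l y]; the
    rest is Fubini. *)
Lemma Rintegral_transfer (g : Borel X -> R) : bounded_measurable g ->
  \int[mu]_y transfer g y = \int[mu]_y g y.
Proof.
move=> bg.
rewrite [RHS](Rintegral_eq_pushforward (m1 := (p \x mu)%E) mom)//; last first.
  move=> A /hmu ->; apply: eq_integral => l _; congr (mu _).
  by apply/seteqP; split => y; rewrite /xsection/= inE.
by rewrite Rintegral_prod2//; exact: bounded_measurable_om.
Qed.

Lemma Rintegral_iter_transfer (g : Borel X -> R) k : bounded_measurable g ->
  \int[mu]_y iter k transfer g y = \int[mu]_y g y.
Proof.
move=> bg; elim: k => //= k IH.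
by rewrite Rintegral_transfer//; exact: bounded_measurable_iter_transfer.
Qed.

End stationary.

Variable P : probability (Omega L) R.
Hypothesis hP : is_product_measure p P.

(** The letter [s k] acts first, directly on [x], in the backward composition of length [k.+1];
    integrating it separately produces one more [transfer]. This links the operator to the
    compositions that weak hyperbolicity controls. *)
Lemma iter_transferE (g : Borel X -> R) k x : bounded_measurable g ->
  iter k transfer g x = \int[P]_s g (bcomp om s k x).
Proof.
move=> bg; elim: k x => [|k IH] x.
  by rewrite /= Rintegral_cst//= probability_setT mulr1.
rewrite (Rintegral_resample_swap hP k)/=; last first.
  have mx : measurable_fun [set: Omega L] (fun s : Omega L =>
    (s, x) : Omega L * Borel X).
    exact: measurable_fun_pair.
  exact: (bounded_measurable_comp (measurableT_comp (measurable_bcomp k.+1)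
    mx)).
apply: eq_Rintegral => l _; rewrite IH; apply: eq_Rintegral => s _.
by rewrite resample_id bcomp_resample.
Qed.

(** Subtracting [transfer g] at time [i] gives orthogonal increments. Moving it to time [i.+1],
    which lets the result be iterated in [k], only adds a telescoping sum. *)
Lemma ae_transfer_average (g : Borel X -> R) x : bounded_measurable g ->
  {ae P, forall s : Omega L,
    (fun n => n.+1%:R^-1 * \sum_(0 <= i < n.+1)
       (g (fcomp om s i.+1 x) - transfer g (fcomp om s i.+1 x))) @ \oo --> (0 :
         R)}.
Proof.
move=> bg; have bT := bounded_measurable_transfer bg.
have [_ [M gM]] := bg; have [_ [N TN]] := bT.
pose D i (s : Omega L) := g (fcomp om s i.+1 x) - transfer g (fcomp om s i x).
have bD i : bounded_measurable (D i).
  by apply: bounded_measurableB; [exact: (bounded_measurable_comp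
    (measurable_fcomp i.+1 x) bg)|
    exact: (bounded_measurable_comp (measurable_fcomp i x) bT)].
have DMN i s : `|D i s| <= M + N.
  by rewrite (le_trans (ler_normB _ _))// lerD.
(* [D i] does not involve the letter [s j], while [D j] has mean zero in that letter. *)
have orthoD i j : (i < j)%N -> \int[P]_s (D i s * D j s) = 0.
  move=> ij; rewrite (Rintegral_resample hP j); last exact: bounded_measurableM.
  have Di s l : D i (resample j s l) = D i s by rewrite /D !fcomp_resample//
    ltnW.
  have Dj s l : D j (resample j s l) =
      g (om l (fcomp om s j x)) - transfer g (fcomp om s j x).
    by rewrite /D /= resample_id fcomp_resample.
  under eq_Rintegral => s _.
    under eq_Rintegral do rewrite Di Dj.
    rewrite RintegralZl//; last first.
      apply: bounded_measurable_integrable; apply: bounded_measurableB;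
        last exact: bounded_measurable_cst.
      exact: (bounded_measurable_pair2 _ (bounded_measurable_om bg)).
    rewrite RintegralB//; last 2 first.
    - apply: bounded_measurable_integrable.
      exact: (bounded_measurable_pair2 _ (bounded_measurable_om bg)).
    - apply: bounded_measurable_integrable; exact: bounded_measurable_cst.
    rewrite Rintegral_cst//= probability_setT mulr1 subrr mulr0.
    over.
  by rewrite Rintegral_cst// mul0r.
have := orthogonal_slln (fun i => (bD i).1) DMN orthoD.
apply: filterS => s Ds.
(* The telescoping leaves one boundary term, at most [N + N] in absolute value before division by
   [n.+1]. *)
have -> : (fun n => n.+1%:R^-1 * \sum_(0 <= i < n.+1)
     (g (fcomp om s i.+1 x) - transfer g (fcomp om s i.+1 x))) =
   (fun n => n.+1%:R^-1 * \sum_(0 <= i < n.+1) D i s +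
     n.+1%:R^-1 * (transfer g x - transfer g (fcomp om s n.+1 x))).
  apply/funext => n; rewrite -mulrDr; congr (_ * _).
  elim: n => [|n IH]; first by rewrite !big_nat1 /D /= addrA subrK.
  by rewrite big_nat_recr//= IH [in RHS]big_nat_recr//= /D /=; ring.
rewrite -[X in _ --> X](addr0 (0 : R)); apply: cvgD => //.
apply/norm_cvg0P.
apply: (squeeze_cvgr (f := fun=> 0) (h := fun n => n.+1%:R^-1 * (N + N))).
- apply: nearW => n; rewrite normr_ge0/= normrM normfV normr_nat ler_wpM2l
    ?invr_ge0//.
  by rewrite (le_trans (ler_normB _ _))// lerD.
- exact: cvg_cst.
- by rewrite -[X in _ --> X](mul0r (N + N)); apply: cvgMl; exact: cvg_harmonic.
Qed.

(** Write g - T^{k+1} g = (g - T^k g) + (T^k g - T (T^k g)) and apply [ae_transfer_average] to T^k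
    g. *)
Lemma ae_iter_transfer_average (g : Borel X -> R) x k : bounded_measurable g ->
  {ae P, forall s : Omega L,
    (fun n => n.+1%:R^-1 * \sum_(0 <= i < n.+1)
       (g (fcomp om s i.+1 x) - iter k transfer g (fcomp om s i.+1 x))) @ \oo
         --> (0 : R)}.
Proof.
move=> bg; elim: k => [|k IH].
  apply: aeW => s; under eq_fun do under eq_bigr do rewrite subrr.
  under eq_fun do rewrite big1// mulr0.
  exact: cvg_cst.
have := ae_transfer_average x (bounded_measurable_iter_transfer k bg).
apply: filterS2 IH => s Hk HT.
rewrite -[X in _ --> X](addr0 (0 : R)).
under eq_fun => n.
  under eq_bigr => i _.
    rewrite iterS -(subrKA (iter k transfer g (fcomp om s i.+1 x))).
    over.
  rewrite big_split mulrDr.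
  over.
exact: cvgD.
Qed.

End random_iteration.

(** * Boundedness and uniform continuity on a compact metric space *)

Section compact_metric.
Context {R : realType} (X : pmetricType R).
Hypothesis cX : compact [set: X].

Lemma near_mdist (x : X) (r : R) : 0 < r -> nbhs x [set y | mdist x y < r].
Proof. by move=> r0; rewrite -[X in nbhs _ X]ballEmdist;
  exact: nbhsx_ballx. Qed.

(** Distances to [point] are locally bounded, hence bounded by compactness in its near-covering
    form; the triangle inequality through [point] does the rest. *)
Lemma compact_mdist_bounded : exists M : R, forall x y : X, mdist x y <= M.
Proof.
have : near_covering [set: X] by apply/compact_near_coveringP.
move=> /(_ R (pinfty_nbhs R) (fun M x => mdist point x <= M)) [].
  move=> x _; exists ([set y | mdist x y < 1], [set M | mdist point x + 1 < M]).
    by split=> /=; [exact: near_mdist|exists (mdist point x + 1); split;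
      [exact: num_real|]].
  move=> [y M] /= [xy xM]; apply: le_trans (ltW xM).
  by rewrite (le_trans (metric_triangle _ x _))// lerD2l ltW.
move=> M [_ HM]; exists (2 * (M + 1)) => x y.
have HM1 (z : X) : mdist point z <= M + 1 by apply: (HM (M + 1) _ z I);
  rewrite ltrDl.
rewrite (le_trans (metric_triangle _ point _))// (metric_sym x).
by have := HM1 x; have := HM1 y; lra.
Qed.

(** Compactness makes the distances bounded, so [Diam] is a true supremum and not the default value
    0 that [sup] takes on unbounded sets. *)
Lemma le_mdist_Diam (A : set X) a b : A a -> A b -> mdist a b <= Diam A.
Proof.
have [M HM] := compact_mdist_bounded.
move=> Aa Ab; apply: ub_le_sup; last by exists a => //; exists b.
by exists M => _ [x _ [y _ <-]].
Qed.

Variable f : X -> R.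
Hypothesis cf : continuous f.

Lemma continuous_bounded : exists M : R, forall x, `|f x| <= M.
Proof.
have [M [_ HM]] : bounded_set (f @` [set: X]).
  apply: compact_bounded; apply: continuous_compact => //.
  exact: continuous_subspaceT.
exists (M + 1) => x; apply: HM; first by rewrite ltrDl.
by exists x.
Qed.

(** The near-covering property, along [d] tending to 0 from the right, makes the local moduli of
    continuity uniform. *)
Lemma uniformly_continuous (e : R) : 0 < e ->
  exists2 d : R, 0 < d & forall x y, mdist x y < d -> `|f x - f y| < e.
Proof.
move=> e0.
have : near_covering [set: X] by apply/compact_near_coveringP.
move=> /(_ R (at_right 0) (fun d x => forall y, mdist x y < d -> `|f x - f y| <
  e)) [].
  move=> x _.
  have : \forall y \near x, `|f x - f y| < e / 2.
    by have /cvgrPdist_lt : f @ x --> f x by [exact: cf]; apply;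
      rewrite divr_gt0.
  move=> /metricType_numDomainType.nbhs_mdistP[r /= r0 Hr].
  (* Halving the radius keeps both [z] and any [y] with [mdist z y < d] within [r] of the centre
     [x]. *)
  have r2 : 0 < r / 2 by rewrite divr_gt0.
  exists ([set y | mdist x y < r / 2], [set d | 0 < d < r / 2]).
    split=> /=; first exact: near_mdist.
    near=> d; apply/andP; split; near: d;
      [exact: nbhs_right_gt|exact: nbhs_right_lt].
  move=> [z d] /= [xz /andP[d0 dr]] y zy.
  have fz : `|f x - f z| < e / 2 by apply: Hr => /=; lra.
  have fy : `|f x - f y| < e / 2.
    apply: Hr => /=; apply: le_lt_trans (metric_triangle _ z _) _; lra.
  have -> : f z - f y = (f x - f y) - (f x - f z) by ring.
  by apply: le_lt_trans (ler_normB _ _) _; lra.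
(* [Hd] speaks of positive numbers strictly below [d], hence the witness [d / 2]. *)
move=> d /= d0 Hd; exists (d / 2); first by rewrite divr_gt0.
by move=> x y xy; apply: (Hd (d / 2)) => //=;
  rewrite ?sub0r ?normrN ?gtr0_norm ?divr_gt0//; lra.
Unshelve. all: by end_near. Qed.

End compact_metric.

(** * Uniform convergence of the iterated transfer operator *)

Section weakly_hyperbolic.
Context {R : realType} (X L : pmetricType R).
Hypothesis cX : compact [set: X].
Variable om : L -> X -> X.
Hypothesis mom :
  measurable_fun [set: Borel L * Borel X] (fun z => om z.1 z.2 : Borel X).
Variables (f : X -> R) (cf : continuous f).

Let bf : bounded_measurable (f : Borel X -> R).
Proof.
by split; [exact: measurable_fun_continuous_real|exact: continuous_bounded].
Qed.

(** The base points may vary with [k], because both images lie in the range of the composition,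
    whose diameter tends to 0. *)
Lemma weakly_hyp_seq_cvg (s : nat -> L) (x y : nat -> X) :
  weakly_hyp_seq om s ->
  (fun k => f (bcomp om s k (x k)) - f (bcomp om s k (y k))) @ \oo --> (0 : R).
Proof.
move=> /cvgrPdist_lt hs; apply/cvgrPdist_lt => e e0.
have [d d0 fd] := uniformly_continuous cX cf e0.
near=> k; rewrite sub0r normrN; apply: fd.
apply: le_lt_trans (@le_mdist_Diam _ _ cX (range (bcomp om s k)) _ _ _ _) _;
  [by exists (x k)|by exists (y k)|].
have : `|0 - Diam (range (bcomp om s k))| < d by near: k; exact: hs.
by rewrite sub0r normrN; apply: le_lt_trans; exact: ler_norm.
Unshelve. all: by end_near. Qed.

Variables (p : probability (Borel L) R) (P : probability (Omega L) R).
Hypothesis hP : is_product_measure p P.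
Hypothesis hyp : {ae P, forall s : Omega L, weakly_hyp_seq om s}.
Variable mu : probability (Borel X) R.
Hypothesis hmu : forall B : set X, @measurable _ (Borel X) B ->
  mu B = (\int[p]_(l in [set: Borel L]) mu (om l @^-1` B))%E.

(* Sequences of base points instead of a supremum: this avoids the measurability
   of [s |-> Diam (range (bcomp om s k))]. *)
Lemma iter_transfer_oscillation (x y : nat -> X) :
  (fun k => iter k (transfer om p) f (x k) - iter k (transfer om p) f (y k))
    @ \oo --> (0 : R).
Proof.
pose u k (s : Omega L) := f (bcomp om s k (x k)) - f (bcomp om s k (y k)).
have bb k z : bounded_measurable (fun s : Omega L => f (bcomp om s k z)).
  have mz : measurable_fun [set: Omega L] (fun s : Omega L =>
    (s, z) : Omega L * Borel X).
    exact: measurable_fun_pair.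
  exact: (bounded_measurable_comp (measurableT_comp (measurable_bcomp mom k)
    mz) bf).
have bu k : bounded_measurable (u k) by exact: bounded_measurableB.
have uE k : iter k (transfer om p) f (x k) - iter k (transfer om p) f (y k) =
    \int[P]_s u k s.
  rewrite !(iter_transferE mom hP _ _ bf) RintegralB//;
    exact: bounded_measurable_integrable.
under eq_fun do rewrite uE.
have [M fM] := continuous_bounded cX cf.
have mu_ k : measurable_fun [set: Omega L] (EFin \o u k).
  by apply/measurable_EFinP; exact: (bu k).1.
have u0 : {ae P, forall s : Omega L, [set: Omega L] s ->
    (fun k => (u k s)%:E) @ \oo --> 0%E}.
  have FP : Filter (nbhs (almost_everywhere P)) by exact:
    ae_filter_ringOfSetsType.
  move: hyp; apply: filterS => s hs _; apply: cvg_EFin; first exact: nearW.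
  exact: weakly_hyp_seq_cvg.
have uM : {ae P, forall (s : Omega L) k, [set: Omega L] s ->
    (`|(u k s)%:E| <= (M + M)%:E)%E}.
  by apply: aeW => s k _; rewrite /= lee_fin (le_trans (ler_normB _ _))// lerD.
(* The constant [M + M] dominates every [u k] and is integrable since [P] is finite. *)
have [_ _] := dominated_convergence measurableT mu_ (measurable_cst _) u0
  (finite_measure_integrable_cst P (M + M) measurableT) uM.
by rewrite integral0 => /fine_cvg.
Qed.

(** By contradiction: failure for every [k] provides base points along which the oscillation stays
    above [e]. *)
Lemma iter_transfer_uniform_cvg (e : R) : 0 < e ->
  exists k, forall x, `|iter k (transfer om p) f x - \int[mu]_y f y| <= e.
Proof.
move=> e0; apply: contrapT => /forallNP nk.
have bT k := bounded_measurable_iter_transfer mom p mu k bf.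
(* By stationarity the integral of [f] is also the [mu]-mean of the iterate. If all its differences
   were at most [e], integrating over [y] would place each value within [e] of that mean. *)
have far k : exists z : X * X,
    e < `|iter k (transfer om p) f z.1 - iter k (transfer om p) f z.2|.
  have /existsNP[x /negP] := nk k; rewrite -ltNge => ex.
  apply: contrapT => /forallNP near_.
  move: ex; apply/negP; rewrite -leNgt.
  rewrite -(Rintegral_iter_transfer mom hmu k bf).
  have -> : iter k (transfer om p) f x =
      \int[mu]_(y in [set: Borel X]) iter k (transfer om p) f x.
    by rewrite Rintegral_cst//= probability_setT mulr1.
  have bc : bounded_measurable (fun _ : Borel X => iter k (transfer om p) f x).
    exact: bounded_measurable_cst.
  rewrite -RintegralB//; try exact: bounded_measurable_integrable.
  apply: Rintegral_norm_le; first exact: bounded_measurableB.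
  by move=> y; rewrite leNgt; apply/negP; exact: (near_ (x, y)).
have [z zfar] := choice far.
have /cvgrPdist_lt /(_ e e0) [N _ /(_ N (leqnn N))] :=
  iter_transfer_oscillation (fst \o z) (snd \o z).
by rewrite sub0r normrN /= => /lt_trans /(_ (zfar N)); rewrite ltxx.
Qed.

End weakly_hyperbolic.

Theorem theorem2 (R : realType) (X L : pmetricType R)
  (hX : compact [set: X]) (hL : compact [set: L])
  (om : L -> X -> X) (hom : continuous (fun z : L * X => om z.1 z.2))
  (p : probability (Borel L) R)
  (P : probability (Omega L) R) (hP : is_product_measure p P)
  (hyp : {ae P, forall s : Omega L, weakly_hyp_seq om s})
  (mu : probability (Borel X) R)
  (hmu : forall B : set X, @measurable _ (Borel X) B ->
           mu B = (\int[p]_(l in [set: Borel L]) mu (om l @^-1` B))%E)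
  (f : X -> R) (hf : continuous f) (x : X) :
  {ae P, forall s : Omega L,
     (fun n : nat => n.+1%:R^-1 * \sum_(1 <= j < n.+2) f (fcomp om s j x))
       @ \oo --> \int[mu]_(y in [set: Borel X]) f y}.
Proof.
(* Compact metric spaces are second countable, so joint continuity gives measurability for the
   product of the Borel sigma-algebras. *)
have mom : measurable_fun [set: Borel L * Borel X] (fun z =>
  om z.1 z.2 : Borel X).
  exact: (measurable_fun_continuous_prod (compact_second_countable hL)
    (compact_second_countable hX) hom).
have bf : bounded_measurable (f : Borel X -> R).
  by split; [exact: measurable_fun_continuous_real|exact: continuous_bounded].
(* One null set serves all [k], as a countable union; [k] can then be chosen from [e] after [s] is
   fixed. *)
have : {ae P, forall (s : Omega L) k, (fun n =>
  n.+1%:R^-1 * \sum_(0 <= i < n.+1)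
    (f (fcomp om s i.+1 x) - iter k (transfer om p) f (fcomp om s i.+1 x)))
    @ \oo --> (0 : R)}.
  by apply: ae_foralln => k; exact: (ae_iter_transfer_average mom mu hP).
apply: filterS => s avg; apply/cvgrPdist_le => e e0.
have e2 : 0 < e / 2 by rewrite divr_gt0.
have [k Tk] := iter_transfer_uniform_cvg hX mom hf hP hyp hmu e2.
have /cvgrPdist_lt /(_ _ e2) := avg k.
apply: filterS => n; rewrite sub0r normrN => small.
set I := \int[mu]_y f y; set T := iter k (transfer om p) f in Tk small.
(* The error splits into the average of [f - T], small for large [n], and the average of [T - I], at
   most [e / 2] by uniform closeness along the whole orbit. *)
have -> : I - n.+1%:R^-1 * \sum_(1 <= j < n.+2) f (fcomp om s j x) =
    - (n.+1%:R^-1 * \sum_(0 <= i < n.+1) (f (fcomp om s i.+1 x) - T (fcomp om s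
        i.+1 x)))
    - n.+1%:R^-1 * \sum_(0 <= i < n.+1) (T (fcomp om s i.+1 x) - I).
  rewrite big_add1/= !sumrB sumr_const_nat subn0 -mulr_natl.
  by field; rewrite addrC natr1.
apply: (le_trans (ler_normB _ _)); rewrite normrN.
have : `|n.+1%:R^-1 * \sum_(0 <= i < n.+1) (T (fcomp om s i.+1 x) - I)| <= e /
  2.
  rewrite normrM normfV normr_nat mulrC ler_pdivrMr//.
  apply: le_trans (ler_norm_sum _ _ _) _.
  apply: le_trans (ler_sum _ (fun i _ => Tk (fcomp om s i.+1 x))) _.
  by rewrite sumr_const_nat subn0 mulr_natr.
lra.
Qed.
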